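(* (Soundness and Completeness of Inference) (1) If $\emptyset\vdash\langle\mathbb M,x\rangle:X\Rightarrow\mathcal E,\Pi,\mathcal C$ is derivable, then $\vdash_{\theta(x)}\mathbb M:\theta(X)$ for every $\theta\in\mathrm{sol}(\mathcal E,\Pi,\mathcal C)$. (2) If $\vdash_{\mathcal P}\mathbb M:\mathsf G$, then there are $\mathcal E,\Pi,\mathcal C$ and $\theta$ such that $\emptyset\vdash\langle\mathbb M,x\rangle:X\Rightarrow\mathcal E,\Pi,\mathcal C$ is derivable, $\theta\in\mathrm{sol}(\mathcal E,\Pi,\mathcal C)$, $\theta(X)=\mathsf G$ and $\theta(x)=\mathcal P$.
   Context: Messages $\lambda$ and participants $\mathsf p,\mathsf q,\dots$ are drawn from given sets. Processes are the possibly infinite but regular (finitely many distinct subterms) terms coinductively generated by $P::=\mathbf 0\mid \mathsf p!\{\lambda_i.P_i\}_{i\in I}\mid \mathsf p?\{\lambda_i.P_i\}_{i\in I}$, with $I$ finite nonempty and the $\lambda_i$ pairwise distinct. A multiparty session is $\mathsf p_1[\![P_1]\!]\parallel\cdots\parallel\mathsf p_n[\![P_n]\!]$ with pairwise distinct $\mathsf p_j$, taken modulo structural congruence (parallel composition associative, commutative, with $\mathsf p[\![\mathbf 0]\!]$ neutral); $\mathrm{prt}(\mathbb M)$ is the set of $\mathsf p$ with $\mathbb M\equiv\mathsf p[\![P]\!]\parallel\mathbb M'$ for some $P\neq\mathbf 0$. Global types are regular terms coinductively generated by $\mathsf G::=\mathsf{End}\mid \mathsf p\to\mathsf q:\{\lambda_i.\mathsf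 G_i\}_{i\in I}$ ($I$ finite nonempty, $\lambda_i$ distinct). $\mathrm{paths}(\mathsf G)$ is the greatest set of (finite or infinite) sequences of labels $\mathsf p\lambda\mathsf q$ with $\mathrm{paths}(\mathsf{End})=\{\epsilon\}$ and $\mathrm{paths}(\mathsf p\to\mathsf q:\{\lambda_i.\mathsf G_i\}_{i\in I})=\bigcup_{i}\{\mathsf p\lambda_i\mathsf q\cdot\sigma\mid \sigma\in\mathrm{paths}(\mathsf G_i)\}$; $\mathrm{prt}(\mathsf G)$ is the set of participants occurring in labels of its paths. $\mathrm{depth}(\sigma,\mathsf p)=\inf\{n\mid\mathsf p$ occurs in the $n$-th label of $\sigma\}$ ($\inf\emptyset=\infty$), $\mathrm{depth}(\mathsf G,\mathsf p)=\sup_{\sigma\in\mathrm{paths}(\mathsf G)}\mathrm{depth}(\sigma,\mathsf p)$ if $\mathsf p\in\mathrm{prt}(\mathsf G)$, else $0$; $\mathsf G$ is bounded if $\mathrm{depth}(\mathsf G',\mathsf p)<\infty$ for every global type $\mathsf G'$ occurring in $\mathsf G$ and every $\mathsf p\in\mathrm{prt}(\mathsf G')$. Typing $\vdash_{\mathcal P}\mathbb M:\mathsf G$ is the largest relation (coinductive rules, sessions modulo congruence) closed under: (End) $\vdash_\emptyset\mathsf p[\![\mathbf 0]\!]:\mathsf{End}$; (Comm) if for all $i\in I$: $\vdash_{\mathcal P_i}\mathsf p[\![P_i]\!]\parallel\mathsf q[\![Q_i]\!]\parallel\mathbb M:\mathsf G_i$ and $(\mathrm{prt}(\mathsf G_i)\cup\mathcal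 P_i)\setminus\{\mathsf p,\mathsf q\}=\mathrm{prt}(\mathbb M)$, and $I\subseteq J$ and $\mathsf G=\mathsf p\to\mathsf q:\{\lambda_i.\mathsf G_i\}_{i\in I}$ is bounded, then $\vdash_{\bigcup_i\mathcal P_i}\mathsf p[\![\mathsf q!\{\lambda_i.P_i\}_{i\in I}]\!]\parallel\mathsf q[\![\mathsf p?\{\lambda_j.Q_j\}_{j\in J}]\!]\parallel\mathbb M:\mathsf G$; (Weak) if $\vdash_{\mathcal P_1}\mathbb M_1:\mathsf G$ and $\mathcal P_2=\mathrm{prt}(\mathbb M_2)\neq\emptyset$ then $\vdash_{\mathcal P_1\cup\mathcal P_2}\mathbb M_1\parallel\mathbb M_2:\mathsf G$. Inference: type patterns are finite terms $\mathsf T::=\mathsf{End}\mid\mathsf p\to\mathsf q:\{\lambda_i.\mathsf T_i\}_{i\in I}\mid X$ with $X$ from a countable set of type variables; p-set patterns are $\mathbb P::=\mathcal P\mid x\mid\mathbb P\cup\mathbb P$ with $\mathcal P$ a finite set of participants and $x$ from a countable set of p-set variables. A substitution $\theta$ is a finite partial map sending type variables to global types and p-set variables to finite sets of participants; $\mathsf T\theta$, $\mathbb P\theta$ denote application. A system of type equations $\mathcal E$ is a finite set of equations $X=\mathsf T$ with at most one equation per variable; a system of p-set equations $\Pi$ is a finite set of equations $x=\mathbb P$ with at most one per variable. $\theta$ solves $\mathcal E$ if all variables of $\mathcal E$ are in $\mathrm{dom}(\theta)$ and for each $X=\mathsf T$ in $\mathcal E$, $\theta(X)=\mathsf T\theta$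 and $\theta(X)$ is bounded; it solves $\Pi$ if all variables of $\Pi$ are in $\mathrm{dom}(\theta)$ and $\theta(x)=\mathbb P\theta$ for each $x=\mathbb P$ in $\Pi$. A p-condition has the form $(\mathrm{prt}(X)\cup x)\setminus\{\mathsf p,\mathsf q\}=\mathcal P$; $\theta$ agrees with it if $(\mathrm{prt}(\theta(X))\cup\theta(x))\setminus\{\mathsf p,\mathsf q\}=\mathcal P$. $\mathrm{sol}(\mathcal E,\Pi,\mathcal C)$ is the set of substitutions solving $\mathcal E$ and $\Pi$ and agreeing with every p-condition in the set $\mathcal C$. A goal is $\langle\mathbb M,x\rangle:X$. Inference judgments $\mathcal S\vdash\langle\mathbb M,x\rangle:X\Rightarrow\mathcal E,\Pi,\mathcal C$ ($\mathcal S$ a set of goals with pairwise distinct variables, all different from $X,x$; sessions modulo congruence) are derived inductively by: (End) $\mathcal S\vdash\langle\mathsf p[\![\mathbf 0]\!],x\rangle:X\Rightarrow\{X=\mathsf{End}\},\{x=\emptyset\},\emptyset$. (Cycle) $\mathcal S\cup\{\langle\mathbb M,y\rangle:Y\}\vdash\langle\mathbb M,x\rangle:X\Rightarrow\{X=Y\},\{x=y\},\emptyset$. (Comm) If $P=\mathsf q!\{\lambda_i.P_i\}_{i\in I}$, $Q=\mathsf p?\{\lambda_j.Q_j\}_{j\in J}$, $I\subseteq J$, $Y_i,y_i$ are fresh variables, $\mathcal S'=\mathcal S\cup\{\langle\mathsf p[\![P]\!]\parallel\mathsf q[\![Q]\!]\parallel\mathbb M,x\rangle:X\}$ and $\mathcal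 S'\vdash\langle\mathsf p[\![P_i]\!]\parallel\mathsf q[\![Q_i]\!]\parallel\mathbb M,y_i\rangle:Y_i\Rightarrow\mathcal E_i,\Pi_i,\mathcal C_i$ for all $i\in I$, then $\mathcal S\vdash\langle\mathsf p[\![P]\!]\parallel\mathsf q[\![Q]\!]\parallel\mathbb M,x\rangle:X\Rightarrow\mathcal E,\Pi,\mathcal C$ with $\mathcal E=\{X=\mathsf p\to\mathsf q:\{\lambda_i.Y_i\}_{i\in I}\}\cup\bigcup_i\mathcal E_i$, $\Pi=\{x=\bigcup_i y_i\}\cup\bigcup_i\Pi_i$, $\mathcal C=\{(\mathrm{prt}(Y_i)\cup y_i)\setminus\{\mathsf p,\mathsf q\}=\mathrm{prt}(\mathbb M)\mid i\in I\}\cup\bigcup_i\mathcal C_i$. (Weak) If $Y,y$ are fresh, $\mathcal P=\mathrm{prt}(\mathbb M_2)\neq\emptyset$ and $\mathcal S\cup\{\langle\mathbb M_1\parallel\mathbb M_2,x\rangle:X\}\vdash\langle\mathbb M_1,y\rangle:Y\Rightarrow\mathcal E_1,\Pi_1,\mathcal C$, then $\mathcal S\vdash\langle\mathbb M_1\parallel\mathbb M_2,x\rangle:X\Rightarrow\{X=Y\}\cup\mathcal E_1,\{x=y\cup\mathcal P\}\cup\Pi_1,\mathcal C$. *)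

(* Defs.v *)
From Stdlib Require List.
From mathcomp Require Import all_boot finmap.
From mathcomp Require Import boolp classical_sets.

Set Implicit Arguments.
Unset Strict Implicit.
Unset Printing Implicit Defensive.

Local Open Scope fset_scope.
Local Open Scope fmap_scope.
Local Open Scope classical_set_scope.

Section Syntax.
Context (Part Msg : choiceType).

(* A family {lambda_i. t_i}_(i in I) with I finite and the lambda_i pairwise
   distinct is a finite map from messages; its domain plays the role of I. *)

CoInductive proc : Type :=
| PNil
| POut of Part & {fmap Msg -> proc}
| PIn of Part & {fmap Msg -> proc}.

CoInductive gtree : Type :=
| GEnd
| GComm of Part & Part & {fmap Msg -> gtree}.

Implicit Types (Ps Qs : {fmap Msg -> proc}) (Gs Hs : {fmap Msg -> gtree}).

(* Equality of possibly infinite terms is bisimilarity: Leibniz equality on a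
   coinductive type is strictly finer. *)

CoInductive proc_eq : proc -> proc -> Prop :=
| proc_eq_Nil : proc_eq PNil PNil
| proc_eq_Out q Ps Qs :
    domf Ps = domf Qs ->
    (forall l P Q, Ps.[? l] = Some P -> Qs.[? l] = Some Q -> proc_eq P Q) ->
    proc_eq (POut q Ps) (POut q Qs)
| proc_eq_In q Ps Qs :
    domf Ps = domf Qs ->
    (forall l P Q, Ps.[? l] = Some P -> Qs.[? l] = Some Q -> proc_eq P Q) ->
    proc_eq (PIn q Ps) (PIn q Qs).

CoInductive gtree_eq : gtree -> gtree -> Prop :=
| gtree_eq_End : gtree_eq GEnd GEnd
| gtree_eq_Comm p q Gs Hs :
    domf Gs = domf Hs ->
    (forall l G H, Gs.[? l] = Some G -> Hs.[? l] = Some H -> gtree_eq G H) ->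
    gtree_eq (GComm p q Gs) (GComm p q Hs).

(* [proc_sub P' P]: the term P' occurs in P. *)
Inductive proc_sub (P' : proc) : proc -> Prop :=
| proc_sub_refl : proc_sub P' P'
| proc_sub_Out q Ps l P :
    Ps.[? l] = Some P -> proc_sub P' P -> proc_sub P' (POut q Ps)
| proc_sub_In q Ps l P :
    Ps.[? l] = Some P -> proc_sub P' P -> proc_sub P' (PIn q Ps).

Inductive gtree_sub (G' : gtree) : gtree -> Prop :=
| gtree_sub_refl : gtree_sub G' G'
| gtree_sub_Comm p q Gs l G :
    Gs.[? l] = Some G -> gtree_sub G' G -> gtree_sub G' (GComm p q Gs).

Definition proc_regular (P : proc) : Prop :=
  exists s : seq proc, forall P', proc_sub P' P ->
    exists2 Q, List.In Q s & proc_eq P' Q.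

Definition gtree_regular (G : gtree) : Prop :=
  exists s : seq gtree, forall G', gtree_sub G' G ->
    exists2 H, List.In H s & gtree_eq G' H.

Definition is_process (P : proc) : Prop :=
  [/\ forall q Ps, proc_sub (POut q Ps) P -> domf Ps != fset0,
      forall q Ps, proc_sub (PIn q Ps) P -> domf Ps != fset0
    & proc_regular P].

Definition is_gtype (G : gtree) : Prop :=
  (forall p q Gs, gtree_sub (GComm p q Gs) G -> domf Gs != fset0) /\
  gtree_regular G.

Record gtype : Type := GType { gtype_tree :> gtree; _ : is_gtype gtype_tree }.

Inductive session : Type :=
| Single of Part & proc
| Par of session & session.

Local Notation "p ⟦ P ⟧" := (Single p P) (at level 10, P at level 99).
Local Notation "M ∥ N" := (Par M N) (at level 50, left associativity).

Inductive scong : session -> session -> Prop :=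
| scong_refl M : scong M M
| scong_sym M N : scong M N -> scong N M
| scong_trans M N K : scong M N -> scong N K -> scong M K
| scong_Par M M' N N' : scong M M' -> scong N N' -> scong (M ∥ N) (M' ∥ N')
| scong_ParA M N K : scong ((M ∥ N) ∥ K) (M ∥ (N ∥ K))
| scong_ParC M N : scong (M ∥ N) (N ∥ M)
| scong_Par0 M p : scong (M ∥ p⟦PNil⟧) M
| scong_proc p P Q : proc_eq P Q -> scong (p⟦P⟧) (p⟦Q⟧).

Local Notation "M ≡ N" := (scong M N) (at level 70).

Fixpoint components (M : session) : seq (Part * proc) :=
  match M with
  | Single p P => [:: (p, P)]
  | Par M N => components M ++ components N
  end.

Definition is_session (M : session) : Prop :=
  uniq [seq pP.1 | pP <- components M] /\
  forall p P, List.In (p, P) (components M) -> is_process P.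

Definition prtS (M : session) : set Part :=
  [set p | exists P M', P <> PNil /\ M ≡ p⟦P⟧ ∥ M'].

Definition label : Type := Part * Msg * Part.

CoInductive trace : Type :=
| tnil
| tcons of label & trace.

Fixpoint trace_nth (s : trace) (n : nat) : option label :=
  match s, n with
  | tnil, _ => None
  | tcons a _, 0 => Some a
  | tcons _ s', n'.+1 => trace_nth s' n'
  end.

CoInductive paths : gtree -> trace -> Prop :=
| paths_End : paths GEnd tnil
| paths_Comm p q Gs l G s :
    Gs.[? l] = Some G -> paths G s ->
    paths (GComm p q Gs) (tcons (p, l, q) s).

Definition occurs_at (p : Part) (s : trace) (n : nat) : Prop :=
  exists q l r, trace_nth s n = Some (q, l, r) /\ (p = q \/ p = r).

Definition prtG (G : gtree) : set Part :=
  [set p | exists s n, paths G s /\ occurs_at p s n].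

(* Natural numbers extended with infinity, which is [None]. *)
Definition enat : Type := option nat.

Definition enat_le (a b : enat) : bool :=
  match a, b with
  | _, None => true
  | None, Some _ => false
  | Some m, Some n => m <= n
  end.

Definition enat_inf (A : set nat) : enat :=
  if pselect (exists n, `[< A n >]) is left h then Some (ex_minn h) else None.

Definition enat_sup (A : set enat) : enat :=
  if pselect (exists n, `[< forall a, A a -> enat_le a (Some n) >]) is left h
  then Some (ex_minn h) else None.

(* [trace_nth] counts from 0, positions in a path count from 1. *)
Definition depth_path (s : trace) (p : Part) : enat :=
  enat_inf [set n.+1 | n in occurs_at p s].

Definition depth (G : gtree) (p : Part) : enat :=
  if pselect (prtG G p) is left _
  then enat_sup [set depth_path s p | s in paths G] else Some 0.

Definition bounded (G : gtree) : Prop :=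
  forall G' p, gtree_sub G' G -> prtG G' p -> depth G' p <> None.

(* Each rule works up to congruence through its hypothesis [M ≡ _].  No rule
   checks that participants are pairwise distinct: whenever M is congruent to
   an [is_session] term, so are all the sessions that a rule derives from it.
   This way the residual session of [typ_Comm] and the typed part of [typ_Weak]
   may be the neutral session even if there is no spare participant. *)
CoInductive typing : {fset Part} -> session -> gtree -> Prop :=
| typ_End M p :
    M ≡ p⟦PNil⟧ ->
    typing fset0 M GEnd
| typ_Comm M p q Ps Qs M' (Pi : Msg -> {fset Part}) Gs :
    M ≡ p⟦POut q Ps⟧ ∥ q⟦PIn p Qs⟧ ∥ M' ->
    (domf Ps `<=` domf Qs)%fset ->
    domf Gs = domf Ps ->
    (forall l P Q G,
       Ps.[? l] = Some P -> Qs.[? l] = Some Q -> Gs.[? l] = Some G ->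
       typing (Pi l) (p⟦P⟧ ∥ q⟦Q⟧ ∥ M') G) ->
    (forall l G, Gs.[? l] = Some G ->
       (prtG G `|` [set` Pi l]) `\` [set p; q] = prtS M') ->
    bounded (GComm p q Gs) ->
    typing (\bigcup_(l <- domf Ps) Pi l)%fset M (GComm p q Gs)
| typ_Weak M M1 M2 (P1 P2 : {fset Part}) G :
    M ≡ M1 ∥ M2 ->
    typing P1 M1 G ->
    [set` P2] = prtS M2 ->
    P2 != fset0 ->
    typing (P1 `|` P2)%fset M G.

Definition tvar : Type := nat.
Definition pvar : Type := nat.

Inductive tpat : Type :=
| TEnd
| TComm of Part & Part & {fmap Msg -> tpat}
| TVar of tvar.

Implicit Types (Ts : {fmap Msg -> tpat}).

Inductive ppat : Type :=
| PSet of {fset Part}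
| PVar of pvar
| PUnion of ppat & ppat.

Inductive tvar_in (X : tvar) : tpat -> Prop :=
| tvar_in_Var : tvar_in X (TVar X)
| tvar_in_Comm p q Ts l T :
    Ts.[? l] = Some T -> tvar_in X T -> tvar_in X (TComm p q Ts).

Fixpoint pvar_in (x : pvar) (U : ppat) : Prop :=
  match U with
  | PSet _ => False
  | PVar y => x = y
  | PUnion U1 U2 => pvar_in x U1 \/ pvar_in x U2
  end.

(* Type variables and p-set variables have separate namespaces. *)
Record subst : Type := Subst {
  tsub : {fmap tvar -> gtype};
  psub : {fmap pvar -> {fset Part}}
}.

(* The values chosen outside the domain of the substitution are irrelevant:
   below, patterns are only instantiated when their variables are in it. *)
Fixpoint tinst (theta : subst) (T : tpat) : gtree :=
  match T with
  | TEnd => GEnd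
  | TComm p q Ts => GComm p q [fmap l : domf Ts => tinst theta (Ts l)]
  | TVar X => if (tsub theta).[? X] is Some G then gtype_tree G else GEnd
  end.

Fixpoint pinst (theta : subst) (U : ppat) : {fset Part} :=
  match U with
  | PSet A => A
  | PVar x => odflt fset0 (psub theta).[? x]
  | PUnion U1 U2 => pinst theta U1 `|` pinst theta U2
  end%fset.

Definition teqs : Type := set (tvar * tpat).
Definition peqs : Type := set (pvar * ppat).

Definition is_system (V T : Type) (E : set (V * T)) : Prop :=
  (exists s : seq (V * T), forall e, E e <-> List.In e s) /\
  forall X T1 T2, E (X, T1) -> E (X, T2) -> T1 = T2.

(* The p-condition (prt(X) ∪ x) \ {p, q} = P *)
Record pcond : Type := PCond {
  pc_tvar : tvar;
  pc_pvar : pvar;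
  pc_snd : Part;
  pc_rcv : Part;
  pc_set : {fset Part}
}.

Definition solves_teqs (theta : subst) (E : teqs) : Prop :=
  (forall X T Y, E (X, T) -> Y = X \/ tvar_in Y T -> Y \in domf (tsub theta)) /\
  forall X T, E (X, T) -> exists G : gtype,
    [/\ (tsub theta).[? X] = Some G, gtree_eq G (tinst theta T) & bounded G].

Definition solves_peqs (theta : subst) (Pi : peqs) : Prop :=
  (forall x U y, Pi (x, U) -> y = x \/ pvar_in y U -> y \in domf (psub theta)) /\
  forall x U, Pi (x, U) -> (psub theta).[? x] = Some (pinst theta U).

Definition agrees (theta : subst) (c : pcond) : Prop :=
  exists (G : gtype) (P : {fset Part}),
    [/\ (tsub theta).[? pc_tvar c] = Some G,
        (psub theta).[? pc_pvar c] = Some P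
      & (prtG G `|` [set` P]) `\` [set pc_snd c; pc_rcv c] = [set` pc_set c]].

Definition sol (E : teqs) (Pi : peqs) (C : set pcond) : set subst :=
  [set theta | [/\ solves_teqs theta E, solves_peqs theta Pi
                 & forall c, C c -> agrees theta c]].

Record goal : Type := Goal {
  goal_session : session;
  goal_pvar : pvar;
  goal_tvar : tvar
}.

Definition goals_wf (S : set goal) (x : pvar) (X : tvar) : Prop :=
  (forall g g', S g -> S g' -> g <> g' ->
     goal_pvar g <> goal_pvar g' /\ goal_tvar g <> goal_tvar g') /\
  (forall g, S g -> goal_pvar g <> x /\ goal_tvar g <> X).

Definition punion (s : seq pvar) : ppat :=
  if s is x :: s' then foldl PUnion (PVar x) [seq PVar y | y <- s']
  else PSet fset0.

(* [infer S M x X E Pi C] is the judgment S |- <M, x> : X => E, Pi, C.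
   Freshness: [goals_wf], required of the premises, makes the variables
   introduced by a rule differ from X, x and from those of all the goals in S.
   Every variable introduced in a derivation is the left-hand side of an
   equation it produces, so in [inf_Comm] the disjointness of the left-hand
   sides says that distinct premises introduce distinct variables. *)
Inductive infer :
  set goal -> session -> pvar -> tvar -> teqs -> peqs -> set pcond -> Prop :=
| inf_End S M x X p :
    goals_wf S x X ->
    M ≡ p⟦PNil⟧ ->
    infer S M x X [set (X, TEnd)] [set (x, PSet fset0)] set0
| inf_Cycle S M M' x X y Y :
    goals_wf S x X ->
    S (Goal M' y Y) -> M ≡ M' ->
    infer S M x X [set (X, TVar Y)] [set (x, PVar y)] set0
| inf_Comm S M x X p q Ps Qs M' (PM' : {fset Part}) (y : Msg -> pvar) (Y : Msg -> tvar)
    (E : Msg -> teqs) (Pi : Msg -> peqs) (C : Msg -> set pcond) :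
    goals_wf S x X ->
    M ≡ p⟦POut q Ps⟧ ∥ q⟦PIn p Qs⟧ ∥ M' ->
    (domf Ps `<=` domf Qs)%fset ->
    [set` PM'] = prtS M' ->
    (forall l P Q, Ps.[? l] = Some P -> Qs.[? l] = Some Q ->
       infer (S `|` [set Goal M x X]) (p⟦P⟧ ∥ q⟦Q⟧ ∥ M') (y l) (Y l)
         (E l) (Pi l) (C l)) ->
    (forall l l', l \in domf Ps -> l' \in domf Ps -> l <> l' ->
       [set e.1 | e in E l] `&` [set e.1 | e in E l'] = set0 /\
       [set e.1 | e in Pi l] `&` [set e.1 | e in Pi l'] = set0) ->
    infer S M x X
      ([set (X, TComm p q [fmap l : domf Ps => TVar (Y (val l))])]
         `|` \bigcup_(l in [set` domf Ps]) E l)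
      ([set (x, punion [seq y l | l <- domf Ps])]
         `|` \bigcup_(l in [set` domf Ps]) Pi l)
      ([set PCond (Y l) (y l) p q PM' | l in [set` domf Ps]]
         `|` \bigcup_(l in [set` domf Ps]) C l)
| inf_Weak S M M1 M2 (P : {fset Part}) x X y Y E Pi C :
    goals_wf S x X ->
    M ≡ M1 ∥ M2 ->
    [set` P] = prtS M2 ->
    P != fset0 ->
    infer (S `|` [set Goal M x X]) M1 y Y E Pi C ->
    infer S M x X
      ([set (X, TVar Y)] `|` E)
      ([set (x, PUnion (PVar y) (PSet P))] `|` Pi)
      C.

End Syntax.

(* Main.v *)
Require Import Defs.
From mathcomp Require Import all_boot finmap.
From mathcomp Require Import boolp classical_sets.

(* Soundness.  A solution turns every goal into a typing claim; along an inference
   derivation the claims of the goals in S are accumulated as coinductive hypotheses.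
   Comm and Weak each contribute a typing rule, and Cycle uses a hypothesis.

   Completeness.  Unfold the typing derivation as a tree of states (M, P, G).  Weak
   removes active components, so P only contains participants of M; as processes and
   G are regular, there are finitely many states up to congruence and bisimilarity.
   Each branch is therefore cut by Cycle at its first repeated state, which leaves a
   finite inference derivation.  Its variables are the codes of the tree positions and
   the solution maps a position to the P and the G of its state. *)

Set Implicit Arguments.
Unset Strict Implicit.
Unset Printing Implicit Defensive.

Local Open Scope fset_scope.
Local Open Scope fmap_scope.
Local Open Scope classical_set_scope.

(** * Lookup in finite maps *)

Lemma fnd_fmap_fset (K : choiceType) (V : Type) (A : {fset K}) (F : K -> V) k :
  [fmap x : A => F (fsval x)].[? k] = if k \in A then Some (F k) else None.
Proof.
case: ifPn => kA; last by rewrite not_fnd.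
by rewrite (in_fnd (f := [fmap x : A => F (fsval x)]) kA) ffunE.
Qed.

Lemma fnd_fmap_comp (K : choiceType) (V W : Type) (f : {fmap K -> V}) (h : V -> W) k :
  [fmap x : domf f => h (f x)].[? k] = omap h f.[? k].
Proof.
case: (boolP (k \in domf f)) => kf; last by rewrite !not_fnd.
by rewrite (in_fnd (f := [fmap x : domf f => h (f x)]) kf) ffunE in_fnd.
Qed.

Lemma fnd_domf (K : choiceType) (V : Type) (f : {fmap K -> V}) k v :
  f.[? k] = Some v -> k \in domf f.
Proof. by move=> fk; rewrite -fndSome fk. Qed.

Lemma domf_fnd (K : choiceType) (V : Type) (f : {fmap K -> V}) k :
  k \in domf f -> exists v, f.[? k] = Some v.
Proof. by move=> kf; exists f.[kf]; rewrite in_fnd. Qed.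

Lemma fnd_eqdom (K : choiceType) (V W : Type) (f : {fmap K -> V}) (g : {fmap K -> W})
  k v : domf f = domf g -> f.[? k] = Some v -> exists w, g.[? k] = Some w.
Proof. by move=> fg fk; apply: domf_fnd; rewrite -fg; exact: fnd_domf fk. Qed.

Section Theory.
Context (Part Msg : choiceType).

Local Notation "p ⟦ P ⟧" := (Single p P) (at level 10, P at level 99).
Local Notation "M ∥ N" := (Par M N) (at level 50, left associativity).
Local Notation "M ≡ N" := (scong M N) (at level 70).
Local Notation proc := (proc Part Msg).
Local Notation gtree := (gtree Part Msg).
Local Notation gtype := (gtype Part Msg).
Local Notation session := (session Part Msg).
Local Notation subst := (subst Part Msg).
Local Notation goal := (goal Part Msg).

Implicit Types (P Q : proc) (G H : gtree) (M N : session) (p q : Part).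

(** * Bisimilarity and the notions invariant under it *)

Lemma proc_eq_refl P : proc_eq P P.
Proof.
move: P; cofix IH => -[|q Ps|q Ps]; constructor=> // l P Q -> [->]; exact: IH.
Qed.

Lemma proc_eq_sym P Q : proc_eq P Q -> proc_eq Q P.
Proof.
move: P Q; cofix IH => _ _ [|q Ps Qs e h|q Ps Qs e h]; constructor=> // l P Q hP hQ;
  apply: IH; exact: h hQ hP.
Qed.

Lemma proc_eq_trans P Q R : proc_eq P Q -> proc_eq Q R -> proc_eq P R.
Proof.
move: P Q R; cofix IH => _ _ R [|q Ps Qs e h|q Ps Qs e h] hR.
- exact: hR.
- inversion hR as [|q' Qs' Rs e' h'|]; subst; constructor; first by rewrite e.
  move=> l P R0 hP hR0.
  case: (fnd_eqdom e hP) => Q hQ.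
  exact: IH (h _ _ _ hP hQ) (h' _ _ _ hQ hR0).
- inversion hR as [| |q' Qs' Rs e' h']; subst; constructor; first by rewrite e.
  move=> l P R0 hP hR0.
  case: (fnd_eqdom e hP) => Q hQ.
  exact: IH (h _ _ _ hP hQ) (h' _ _ _ hQ hR0).
Qed.

Lemma gtree_eq_refl G : gtree_eq G G.
Proof.
move: G; cofix IH => -[|p q Gs]; constructor=> // l G H -> [->]; exact: IH.
Qed.

Lemma gtree_eq_sym G H : gtree_eq G H -> gtree_eq H G.
Proof.
move: G H; cofix IH => _ _ [|p q Gs Hs e h]; constructor=> // l G H hG hH;
  apply: IH; exact: h hH hG.
Qed.

Lemma gtree_eq_trans G H K : gtree_eq G H -> gtree_eq H K -> gtree_eq G K.
Proof.
move: G H K; cofix IH => _ _ K [|p q Gs Hs e h] hK; first exact: hK.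
inversion hK as [|p' q' Hs' Ks e' h']; subst; constructor; first by rewrite e.
move=> l G K0 hG hK0.
case: (fnd_eqdom e hG) => H hH.
exact: IH (h _ _ _ hG hH) (h' _ _ _ hH hK0).
Qed.

Lemma paths_eq G H s : gtree_eq G H -> paths G s -> paths H s.
Proof.
move: G H s; cofix IH => G H s [|p q Gs Hs e h] hs.
- by inversion hs; subst; constructor.
- inversion hs as [|p' q' Gs' l G' s' hG' hs']; subst.
  case: (fnd_eqdom e hG') => H' hH'.
  exact: paths_Comm hH' (IH _ _ _ (h _ _ _ hG' hH') hs').
Qed.

Lemma prtG_eq G H : gtree_eq G H -> prtG G = prtG H.
Proof.
move=> GH; apply/seteqP; split=> p [s [n [hs hp]]]; exists s, n; split=> //.
- exact: paths_eq GH hs.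
- exact: paths_eq (gtree_eq_sym GH) hs.
Qed.

Lemma gtree_sub_eq G H G' : gtree_sub G' G -> gtree_eq G H ->
  exists2 H', gtree_sub H' H & gtree_eq G' H'.
Proof.
move=> sub; elim: sub H => [|p q Gs l G1 hG1 _ IH] H GH.
  by exists H => //; constructor.
inversion GH as [|p' q' Gs' Hs e h]; subst.
have [H1 hH1] := fnd_eqdom e hG1.
have [H' hH' eH'] := IH _ (h _ _ _ hG1 hH1).
by exists H' => //; exact: gtree_sub_Comm hH1 hH'.
Qed.

Lemma depth_eq G H p : gtree_eq G H -> depth G p = depth H p.
Proof.
move=> GH; rewrite /depth (prtG_eq GH).
suff -> : @paths Part Msg G = paths H by [].
by apply/seteqP; split=> s; apply: paths_eq => //; exact: gtree_eq_sym.
Qed.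

Lemma bounded_eq G H : gtree_eq G H -> bounded G -> bounded H.
Proof.
move=> GH bG H' p HH' hp.
have [G' GG' eH] := gtree_sub_eq HH' (gtree_eq_sym GH).
by rewrite (depth_eq _ eH); apply: bG GG' _; rewrite -(prtG_eq eH).
Qed.

(** * Subterms of processes and global types *)

Lemma proc_sub_trans P1 P2 P3 : proc_sub P1 P2 -> proc_sub P2 P3 -> proc_sub P1 P3.
Proof.
move=> h12; elim=> [//|q Ps l P hP _ IH|q Ps l P hP _ IH].
- exact: proc_sub_Out hP IH.
- exact: proc_sub_In hP IH.
Qed.

Lemma gtree_sub_trans G1 G2 G3 :
  gtree_sub G1 G2 -> gtree_sub G2 G3 -> gtree_sub G1 G3.
Proof.
move=> h12; elim=> [//|p q Gs l G hG _ IH]; exact: gtree_sub_Comm hG IH.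
Qed.

Lemma is_gtype_sub G H : gtree_sub H G -> is_gtype G -> is_gtype H.
Proof.
move=> HG [h1 [s hs]]; split=> [p q Gs hGs|].
- exact: h1 (gtree_sub_trans hGs HG).
- by exists s => K hK; apply: hs; exact: gtree_sub_trans hK HG.
Qed.

(** * Coinduction for typing *)

Definition typrel := {fset Part} -> session -> gtree -> Prop.

Inductive typing_step (R : typrel) : typrel :=
| step_End M p : M ≡ p⟦PNil _ _⟧ -> typing_step R fset0 M (GEnd _ _)
| step_Comm M p q Ps Qs M' (Pi : Msg -> {fset Part}) Gs :
    M ≡ p⟦POut q Ps⟧ ∥ q⟦PIn p Qs⟧ ∥ M' ->
    (domf Ps `<=` domf Qs)%fset ->
    domf Gs = domf Ps ->
    (forall l P Q G,
       Ps.[? l] = Some P -> Qs.[? l] = Some Q -> Gs.[? l] = Some G ->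
       R (Pi l) (p⟦P⟧ ∥ q⟦Q⟧ ∥ M') G) ->
    (forall l G, Gs.[? l] = Some G ->
       (prtG G `|` [set` Pi l]) `\` [set p; q] = prtS M') ->
    bounded (GComm p q Gs) ->
    typing_step R (\bigcup_(l <- domf Ps) Pi l)%fset M (GComm p q Gs)
| step_Weak M M1 M2 (P1 P2 : {fset Part}) G :
    M ≡ M1 ∥ M2 ->
    R P1 M1 G ->
    [set` P2] = prtS M2 ->
    P2 != fset0 ->
    typing_step R (P1 `|` P2)%fset M G.

Lemma typing_step_mono (R R' : typrel) :
  (forall A M G, R A M G -> R' A M G) ->
  forall A M G, typing_step R A M G -> typing_step R' A M G.
Proof.
move=> RR' A M G [{}M p hM|{}M p q Ps Qs M' Pi Gs hM hd hG hR hp hb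
  |{}M M1 M2 P1 P2 {}G hM hR h2 h0].
- exact: step_End hM.
- by apply: (step_Comm hM) => // l P Q G' hP hQ hG'; apply: RR'; exact: hR hP hQ hG'.
- by apply: (step_Weak hM) h2 h0; exact: RR'.
Qed.

(** The corecursive call sits right below a rule, so guardedness is settled here once; later
    arguments only exhibit relations contained in one step of themselves. *)
Lemma typing_coind (R : typrel) :
  (forall A M G, R A M G -> typing_step R A M G) ->
  forall A M G, R A M G -> typing A M G.
Proof.
move=> hR; cofix IH => A M G /hR.
case=> [{}M p hM|{}M p q Ps Qs M' Pi Gs hM hd hG h hp hb
  |{}M M1 M2 P1 P2 {}G hM h h2 h0].
- exact: typ_End hM.
- by apply: (typ_Comm hM) => // l P Q G' hP hQ hG'; apply: IH; exact: h hP hQ hG'.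
- by apply: (typ_Weak hM) h2 h0; exact: IH.
Qed.

(* Parameterised greatest fixed point of [typing_step], with [R] as the
   assumptions that may be used once a step has been taken. *)
Definition typing_from (R : typrel) : typrel := fun A M G =>
  exists2 U : typrel,
    forall A M G, U A M G -> typing_step (fun A M G => U A M G \/ R A M G) A M G
    & U A M G.

(** The witness joins [Z] with all that follows from [R] or [Z]. Whatever it relates takes one step
    and lands in this union or in [R], so the assumption [Z] is discharged. *)
Lemma typing_from_acc (R Z : typrel) :
  (forall A M G, Z A M G ->
     typing_step (fun A M G => [\/ typing_from (fun A M G => R A M G \/ Z A M G) A M G,
                                   R A M G | Z A M G]) A M G) ->
  forall A M G, Z A M G -> typing_from R A M G.
Proof.
move=> hZ A M G hz.
exists (fun A M G => typing_from (fun A M G => R A M G \/ Z A M G) A M G \/ Z A M G);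
  last by right.
move=> {hz}A {}M {}G [[U hU hu]|/hZ].
- apply: typing_step_mono (hU _ _ _ hu) => A' M' G' [h|[h|h]].
  + by left; left; exists U.
  + by right.
  + by left; right.
- apply: typing_step_mono => A' M' G' [h|h|h].
  + by left; left.
  + by right.
  + by left; right.
Qed.

Lemma typing_from0 (R : typrel) : (forall A M G, ~ R A M G) ->
  forall A M G, typing_from R A M G -> typing A M G.
Proof.
move=> R0 A M G [U hU hu]; apply: typing_coind hu => {}A {}M {}G /hU.
by apply: typing_step_mono => A' M' G' [//|/R0].
Qed.

(** * Soundness *)

Section Soundness.
Context (theta : subst).

(** The claim is closed under congruence and bisimilarity because Cycle matches sessions up to
    congruence and solutions satisfy type equations up to bisimilarity. *)
Definition goal_typed (g : goal) : typrel := fun A M G =>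
  exists H : gtype,
    [/\ M ≡ goal_session g, (psub theta).[? goal_pvar g] = Some A,
        (tsub theta).[? goal_tvar g] = Some H & gtree_eq G H].

Definition goals_typed (S : set goal) : typrel := fun A M G =>
  exists2 g, S g & goal_typed g A M G.

Lemma solves_teqsS (E E' : teqs Part Msg) :
  E `<=` E' -> solves_teqs theta E' -> solves_teqs theta E.
Proof. by move=> EE' [h1 h2]; split=> [X T Y /EE'|X T /EE']; [exact: h1|exact: h2]. Qed.

Lemma solves_peqsS (E E' : peqs Part) :
  E `<=` E' -> solves_peqs theta E' -> solves_peqs theta E.
Proof. by move=> EE' [h1 h2]; split=> [X T Y /EE'|X T /EE']; [exact: h1|exact: h2]. Qed.

Lemma solS (E E' : teqs Part Msg) (Pi Pi' : peqs Part) (C C' : set (pcond Part)) :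
  E `<=` E' -> Pi `<=` Pi' -> C `<=` C' -> sol E' Pi' C' theta -> sol E Pi C theta.
Proof.
move=> EE' PP' CC' [hE hP hC]; split.
- exact: solves_teqsS EE' hE.
- exact: solves_peqsS PP' hP.
- by move=> c /CC' /hC.
Qed.

Lemma pinst_punion (s : seq pvar) :
  pinst theta (punion Part s) = (\bigcup_(y <- s) odflt fset0 (psub theta).[? y])%fset.
Proof.
case: s => [|x s] /=; first by rewrite big_nil.
(* The head pattern is generalised to an arbitrary [U], the accumulator of the left fold in
   [punion]. *)
rewrite big_cons; set U := PVar _ x.
rewrite -[odflt _ _]/(pinst theta U); move: U.
elim: s => [|y s IH] U /=; first by rewrite big_nil fsetU0.
by rewrite IH big_cons /= fsetUA.
Qed.

(** Induction on the derivation. Cycle takes no typing step and can only return a hypothesis, hence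
    the second alternative; the other rules take a step and reach the first. The values of [x] and
    [X] are part of the claim so that the Weak case can instantiate its premise. *)
Lemma infer_sound (S : set goal) M x X E Pi C :
  infer S M x X E Pi C -> sol E Pi C theta ->
  (exists A (G : gtype), (psub theta).[? x] = Some A /\ (tsub theta).[? X] = Some G) /\
  forall A M' G, goal_typed (Goal M x X) A M' G ->
    typing_from (goals_typed S) A M' G \/ goals_typed S A M' G.
Proof.
(* For a rule that takes a typing step, the current goal joins the hypotheses while its premises are
   treated. *)
have accum S' g A M' G' : goal_typed g A M' G' ->
    (forall A M G, goal_typed g A M G ->
       typing_step (fun A M G => typing_from (goals_typed (S' `|` [set g])) A M G \/
                                 goals_typed (S' `|` [set g]) A M G) A M G) ->
    typing_from (goals_typed S') A M' G' \/ goals_typed S' A M' G'.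
  move=> hg hs; left; apply: (typing_from_acc (Z := goal_typed g)) hg => A1 M1 G1 /hs.
  have eS A2 M2 G2 : goals_typed (S' `|` [set g]) A2 M2 G2 ->
      goals_typed S' A2 M2 G2 \/ goal_typed g A2 M2 G2.
    by case=> g' [hg'|->] h; [left; exists g'|right].
  apply: typing_step_mono => A2 M2 G2 [[U hU hu]|/eS [h|h]].
  - apply: Or31; exists U => // A3 M3 G3 /hU.
    by apply: typing_step_mono => A4 M4 G4 [h|/eS h]; [left|right].
  - exact: Or32.
  - exact: Or33.
elim=> {S M x X E Pi C}.
- move=> S M x X p _ hM [[_ hE] [_ hP] _].
  have [G [hG eG _]] := hE X _ erefl; have hx := hP x _ erefl.
  split; first by exists fset0, G.
  move=> A M' G' hg; apply: accum (hg) _ => {hg} {}A {}M' {}G' [H [/= hM' hA hH eH]].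
  move: hx hG; rewrite hA hH => -[->] [HG]; subst H.
  have /= eE := gtree_eq_trans eH eG; inversion eE; subst.
  exact: step_End (scong_trans hM' hM).
- move=> S M N x X y Y _ hS hMN [[hE1 hE] [hP1 hP] _].
  have [G [hG eG _]] := hE X _ erefl; have hx := hP x _ erefl.
  split; first by exists (pinst theta (PVar _ y)), G.
  move=> A M' G' [H [/= hM' hA hH eH]]; right; exists (Goal N y Y) => //.
  (* The domain clauses of a solution provide values for the variables on the right, so the defaults
     of [tinst] and [pinst] are never taken. *)
  have /domf_fnd[H' hH'] : Y \in domf (tsub theta).
    by apply: (hE1 X (TVar _ _ Y)) => //; right; constructor.
  have /domf_fnd[A' hA'] : y \in domf (psub theta).
    by apply: (hP1 x (PVar _ y)) => //; right.
  move: hx hG eG; rewrite hA hH /= hA' hH' => -[->] [<-] eG.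
  exists H'; split=> //=; first exact: scong_trans hMN.
  exact: gtree_eq_trans eG.
- move=> S M x X p q Ps Qs M0 PM0 y Y E Pi C _ hM hdom hPM0 _ IH _ hsol.
  have [[hE1 hE] [hP1 hP] hC] := hsol.
  have [G [hG eG bG]] := hE X _ (or_introl erefl).
  have hx := hP x _ (or_introl erefl).
  split; first by eexists _, G; split; [exact: hx|].
  move=> A M' G' hg; apply: accum (hg) _ => {hg} {}A {}M' {}G' [H [/= hM' hA hH eH]].
  move: hx hG; rewrite hA hH => -[->] [HG]; subst H.
  rewrite pinst_punion big_map.
  have /= eE := gtree_eq_trans eH eG.
  inversion eE as [|p' q' Gs' Hs' edom heq]; subst p' q' G'.
  (* The p-condition of a branch forces both of its variables to have values. *)
  have hCl l : l \in domf Ps -> exists (G : gtype) B,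
    [/\ (tsub theta).[? Y l] = Some G, (psub theta).[? y l] = Some B
      & (prtG G `|` [set` B]) `\` [set p; q] = prtS M0].
    move=> lP; have [|H [B /= [h1 h2 h3]]] := hC (PCond (Y l) (y l) p q PM0).
      by left; exists l.
    by exists H, B; split=> //; rewrite -hPM0.
  have hGl l G' : Gs'.[? l] = Some G' -> l \in domf Ps /\ exists (H : gtype) B,
    [/\ (tsub theta).[? Y l] = Some H, (psub theta).[? y l] = Some B, gtree_eq G' H
      & (prtG G' `|` [set` B]) `\` [set p; q] = prtS M0].
    move=> hG'; have lP : l \in domf Ps by have := fnd_domf hG'; rewrite edom.
    split=> //; have [H [B [h1 h2 h3]]] := hCl _ lP; exists H, B.
    have eH' : gtree_eq G' H.
      apply: heq hG' _.
      by rewrite (fnd_fmap_comp _ (tinst theta)) (fnd_fmap_fset _ (fun l => TVar Part Msg (Y l))) lP /= h1.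
    by split=> //; rewrite (prtG_eq eH').
  have := @step_Comm; apply.
  + exact: scong_trans hM' hM.
  + exact: hdom.
  + exact: edom.
  + move=> l P Q G' hlP hlQ hG'.
    have [lP [H [B [h1 h2 h3 h4]]]] := hGl _ _ hG'.
    apply: (IH l P Q hlP hlQ _).2.
      by apply: solS hsol => z hz; right; exists l.
    by exists H; split=> //=; [exact: scong_refl|rewrite h2].
  + by move=> l G' /hGl[lP [H [B [h1 h2 h3 h4]]]]; rewrite h2.
  + exact: bounded_eq (gtree_eq_sym eH) bG.
- move=> S M M1 M2 P2 x X y Y E Pi C _ hM hP2 hP0 _ IH hsol.
  have [[hE1 hE] [hP1 hP] hC] := hsol.
  have [G [hG eG bG]] := hE X _ (or_introl erefl).
  have hx := hP x _ (or_introl erefl).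
  split; first by eexists _, G; split; [exact: hx|].
  move=> A M' G' hg; apply: accum (hg) _ => {hg} {}A {}M' {}G' [H [/= hM' hA hH eH]].
  move: hx hG; rewrite hA hH => -[->] [HG]; subst H => /=.
  have hsol' : sol E Pi C theta by apply: solS hsol => z hz //; right.
  have [[A' [H' [hA' hH']]] IH'] := IH hsol'.
  apply: (step_Weak (scong_trans hM' hM) _ hP2 hP0).
  apply: IH'; exists H'; split=> //=; first exact: scong_refl.
    by rewrite hA'.
  by move: eG; rewrite /= hH' => eG; exact: gtree_eq_trans eG.
Qed.

End Soundness.
(** * Active components of a session *)

Definition active P : bool := if P is PNil then false else true.

Lemma activeP P : P <> PNil _ _ <-> active P.
Proof. by case: P. Qed.

Lemma active_eq P Q : proc_eq P Q -> active P = active Q.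
Proof. by case. Qed.

(** Counting active components turns congruence into an equation between numbers: [pred1 p] detects
    the participant [p], and [predT] gives a size that Weak decreases. *)
Fixpoint cnt (a : pred Part) M : nat :=
  match M with
  | Single p P => active P && a p
  | Par M N => cnt a M + cnt a N
  end.

(** Inactive components are exempt, since congruence creates and erases them for arbitrary
    participants. *)
Fixpoint all_comp (K : Part -> proc -> Prop) M : Prop :=
  match M with
  | Single p P => active P -> K p P
  | Par M N => all_comp K M /\ all_comp K N
  end.

Lemma cnt_scong a M N : M ≡ N -> cnt a M = cnt a N.
Proof.
elim=> {M N} //=.
- by move=> M N K _ -> _ ->.
- by move=> M M' N N' _ -> _ ->.
- by move=> M N K; rewrite addnA.
- by move=> M N; rewrite addnC.
- by move=> M _; rewrite addn0.
- by move=> p P Q /active_eq ->.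
Qed.

Lemma cnt_leq (a b : pred Part) M : subpred a b -> cnt a M <= cnt b M.
Proof.
move=> ab; elim: M => [p P|M IHM N IHN] /=; last exact: leq_add.
by case: (active P) => //=; case ap: (a p) => //; rewrite (ab _ ap).
Qed.

Lemma all_comp_scong (K : Part -> proc -> Prop) M N :
  (forall p P Q, proc_eq P Q -> K p P -> K p Q) ->
  M ≡ N -> all_comp K M <-> all_comp K N.
Proof.
move=> hK; elim=> {M N} //=; try tauto.
- by move=> M p; split=> // -[].
- move=> p P Q PQ; rewrite (active_eq PQ); split=> h /h; first exact: hK.
  by apply: hK; exact: proc_eq_sym.
Qed.

Lemma all_compS (K K' : Part -> proc -> Prop) M :
  (forall p P, K p P -> K' p P) -> all_comp K M -> all_comp K' M.
Proof.
by move=> KK'; elim: M => [p P h /h /KK'|M IHM N IHN] //= [/IHM ? /IHN].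
Qed.

Lemma all_comp_neq (K : Part -> proc -> Prop) M p :
  all_comp K M -> cnt (pred1 p) M = 0 -> all_comp (fun q P => K q P /\ q != p) M.
Proof.
elim: M => [q P|M IHM N IHN] /=.
  by move=> h + aP; rewrite aP /=; case: eqP => // _ _; split=> //; exact: h.
by move=> [/IHM hM /IHN hN] /eqP; rewrite addn_eq0 => /andP[/eqP/hM ? /eqP/hN].
Qed.

Lemma scong_split M p : 0 < cnt (pred1 p) M ->
  exists P M', active P /\ M ≡ p⟦P⟧ ∥ M'.
Proof.
elim: M => [q P|M IHM N IHN] /=.
  case aP: (active P) => //=; case: eqP => // -> _.
  by exists P, (p⟦PNil _ _⟧); split=> //; apply: scong_sym; exact: scong_Par0.
rewrite addn_gt0 => /orP[/IHM|/IHN] [P [K [aP h]]].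
- exists P, (K ∥ N); split=> //; apply: scong_trans (scong_ParA _ _ _).
  by apply: scong_Par h _; exact: scong_refl.
- exists P, (K ∥ M); split=> //; apply: scong_trans (scong_ParC _ _) _.
  apply: scong_trans (scong_ParA _ _ _).
  by apply: scong_Par h _; exact: scong_refl.
Qed.

Lemma prtSP M p : prtS M p <-> 0 < cnt (pred1 p) M.
Proof.
split=> [[P [M' [/activeP aP /cnt_scong ->]]]|/scong_split[P [M' [aP h]]]].
  by rewrite /= aP eqxx.
by exists P, M'; split=> //; apply/activeP.
Qed.

Fixpoint prt_fset M : {fset Part} :=
  match M with
  | Single p P => if active P then [fset p] else fset0
  | Par M N => prt_fset M `|` prt_fset N
  end%fset.

Lemma in_prt_fset M p : (p \in prt_fset M) = (0 < cnt (pred1 p) M).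
Proof.
elim: M => [q P|M IHM N IHN] /=; last by rewrite inE IHM IHN addn_gt0.
by case: (active P); rewrite inE //= eq_sym; case: (q == p).
Qed.

Lemma prt_fsetE M : [set` prt_fset M] = prtS M.
Proof. by apply/seteqP; split=> p; rewrite prtSP -in_prt_fset. Qed.

Lemma scong_nil M p : cnt predT M = 0 -> M ≡ p⟦PNil _ _⟧.
Proof.
elim: M => [q [|q' Ps|q' Ps]|M IHM N IHN] //= hM.
  apply: scong_trans (scong_sym (scong_Par0 _ p)) _.
  by apply: scong_trans (scong_ParC _ _) _; exact: scong_Par0.
move/eqP: hM; rewrite addn_eq0 => /andP[/eqP/IHM hM /eqP/IHN hN].
by apply: scong_trans (scong_Par hM hN) _; exact: scong_Par0.
Qed.

(** Induction on [ps]: either [p] is inactive and the shorter list suffices, or its component splits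
    off, leaving a rest without [p], and its process is exchanged for a representative in [s]. [p0]
    names the neutral session when [ps] is empty. *)
Lemma sessions_finite (p0 : Part) (ps : seq Part) (s : seq proc) :
  exists L : seq session, forall M, (forall p, cnt (pred1 p) M <= 1) ->
    all_comp (fun p P => p \in ps /\ exists2 Q, List.In Q s & proc_eq P Q) M ->
    exists2 N, List.In N L & M ≡ N.
Proof.
elim: ps => [|p ps [L hL]].
  exists [:: p0⟦PNil _ _⟧] => M _ hM; exists (p0⟦PNil _ _⟧); first by left.
  apply: scong_nil; elim: M hM => [q P|M IHM N IHN] /=; last first.
    by case=> /IHM -> /IHN ->.
  by case: (active P) => // /(_ isT)[].
exists (L ++ List.flat_map (fun N => List.map (fun Q => p⟦Q⟧ ∥ N) s) L) => M cM hM.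
have [/scong_split[P [M' [aP MM']]]|] := ltnP 0 (cnt (pred1 p) M); last first.
  rewrite leqn0 => /eqP /(all_comp_neq hM) {}hM.
  have [|N LN MN] := hL M cM.
    by apply: all_compS hM => q P; rewrite inE => -[[h1 h2] /negPf qp]; move: h1; rewrite qp.
  by exists N => //; apply/List.in_app_iff; left.
have [] := (all_comp_scong _ MM').1 hM.
  move=> q Q Q' QQ' [hq [R sR QR]]; split=> //; exists R => //.
  exact: proc_eq_trans (proc_eq_sym QQ') QR.
move=> /(_ aP)[_ [Q sQ PQ]] hM'.
(* The component in front already accounts for [p], so the bound leaves no active [p] in the
   rest. *)
have cM' q : (p == q) + cnt (pred1 q) M' <= 1.
  by have := cM q; rewrite (cnt_scong _ MM') /= aP.
have [q||N LN MN] := hL M'.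
- by apply: leq_trans (cM' q); exact: leq_addl.
- have : cnt (pred1 p) M' = 0 by have := cM' p; rewrite eqxx; case: (cnt _ _).
  move=> /(all_comp_neq hM'); apply: all_compS => q R.
  by rewrite inE => -[[h1 h2] /negPf qp]; move: h1; rewrite qp.
exists (p⟦Q⟧ ∥ N).
  apply/List.in_app_iff; right; apply/List.in_flat_map; exists N; split=> //.
  exact: (List.in_map (fun Q => p⟦Q⟧ ∥ N)).
by apply: scong_trans MM' _; apply: scong_Par MN; exact: scong_proc.
Qed.

Lemma bounded_End : bounded (GEnd Part Msg).
Proof.
move=> G' p hG [s [n [hs]]]; inversion hG; subst; inversion hs; subst.
by case=> ? [? [? []]]; case: n.
Qed.

(* Weak cannot be iterated forever, as each use removes an active component. *)
Lemma typing_facts A M G : typing A M G ->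
  bounded G /\ forall p, p \in A -> 0 < cnt (pred1 p) M.
Proof.
have [n] := ubnP (cnt predT M); elim: n => // n IH in A M G * => hn hA.
case: hA hn => [{}M p hM _|{}M p q Ps Qs M' Pi Gs hM _ hG _ hp hb _
  |{}M M1 M2 P1 P2 {}G hM h1 h2 h0].
- by split; [exact: bounded_End|].
- split=> // r /bigfcupP[l /[!andbT] hl rl].
  have [Gl hGl] : exists G, Gs.[? l] = Some G by apply: domf_fnd; rewrite hG.
  rewrite (cnt_scong _ hM) /=.
  have [<-|/eqP pr] := eqVneq p r; first by [].
  have [<-|/eqP qr] := eqVneq q r; first by rewrite addnAC addnC.
  (* A participant other than [p] and [q] in the p-set of some branch lies in the residual session
     by the condition on that branch. *)
  have : prtS M' r.
    rewrite -(hp _ _ hGl); split; first by right.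
    by case=> /esym.
  by move/prtSP=> h; rewrite addn_gt0 h orbT.
- rewrite (cnt_scong _ hM) /= => hn.
  have P2E r : r \in P2 -> 0 < cnt (pred1 r) M2.
    by move=> hr; apply/prtSP; rewrite -h2.
  (* [M2] is active because [P2] is nonempty, so the induction applies to the smaller [M1]. *)
  have M2_gt0 : 0 < cnt predT M2.
    by case/fset0Pn: h0 => r /P2E h; apply: leq_trans h _; exact: cnt_leq.
  have [|bG hP1] := IH _ _ _ _ h1.
    by rewrite -ltnS; apply: leq_trans hn; rewrite ltnS -addn1 leq_add2l.
  split=> // r; rewrite (cnt_scong _ hM) /= addn_gt0 inE => /orP[/hP1 ->//|/P2E ->].
  by rewrite orbT.
Qed.

Lemma all_comp_components (K : Part -> proc -> Prop) M :
  (forall p P, List.In (p, P) (components M) -> K p P) -> all_comp K M.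
Proof.
elim: M => [p P h _|M IHM N IHN h] /=; first by apply: h; left.
by split; [apply: IHM|apply: IHN] => p P hP; apply: h; apply/List.in_app_iff;
  [left|right].
Qed.

Lemma cnt_components M p : cnt (pred1 p) M <= count_mem p [seq pP.1 | pP <- components M].
Proof.
elim: M => [q P|M IHM N IHN] /=; last by rewrite map_cat count_cat leq_add.
by case: (active P) => //=; rewrite addn0.
Qed.

Lemma components_neq0 M : exists p P, List.In (p, P) (components M).
Proof.
elim: M => [p P|M [p [P h]] N _] /=; exists p, P; first by left.
by apply/List.in_app_iff; left.
Qed.

(** * Systems of equations *)

Lemma is_systemU (T : Type) (E E' : set (nat * T)) :
  is_system E -> is_system E' ->
  (forall e e', E e -> E' e' -> e.1 <> e'.1) -> is_system (E `|` E').
Proof.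
move=> [[s hs] fE] [[s' hs'] fE'] d; split.
  by exists (s ++ s') => e; rewrite List.in_app_iff -hs -hs'.
move=> X T1 T2 [h1|h1] [h2|h2].
- exact: fE h1 h2.
- by case: (d _ _ h1 h2).
- by case: (d _ _ h2 h1).
- exact: fE' h1 h2.
Qed.

Lemma is_system1 (T : Type) (e : nat * T) : is_system [set e].
Proof.
split; last by case: e => Y T0 X T1 T2 /= [_ ->] [_ ->].
by exists [:: e] => e' /=; split=> [->|[->|[]]]; [left|].
Qed.

Lemma is_system_bigcup (T : Type) (s : seq Msg) (F : Msg -> set (nat * T)) :
  (forall l, l \in s -> is_system (F l)) ->
  (forall l l' e e', l \in s -> l' \in s -> l <> l' -> F l e -> F l' e' -> e.1 <> e'.1) ->
  is_system (\bigcup_(l in [set` s]) F l).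
Proof.
elim: s => [|l s IH] hF d.
  by split; [exists [::] => e; split=> // -[l] //|move=> X T1 T2 [l]].
have [ls|ls] := boolP (l \in s).
  have -> : [set` l :: s] = [set` s].
    by apply/seteqP; split=> l' /=; rewrite inE => h; [case/predU1P: h => [->|]|rewrite h orbT].
  apply: IH => [l' hl'|l' l'' e e' hl' hl'']; first by apply: hF; rewrite inE hl' orbT.
  by apply: d; rewrite inE ?hl' ?hl'' orbT.
have -> : \bigcup_(l in [set` l :: s]) F l = F l `|` \bigcup_(l in [set` s]) F l.
  apply/seteqP; split=> [e [l' /=]|e [h|[l' /= hl' h]]].
  - by rewrite inE => /predU1P[->|hl'] h; [left|right; exists l'].
  - by exists l => //=; rewrite inE eqxx.
  - by exists l' => //=; rewrite inE hl' orbT.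
apply: is_systemU; first by apply: hF; rewrite inE eqxx.
  apply: IH => [l' hl'|l' l'' e e' hl' hl'']; first by apply: hF; rewrite inE hl' orbT.
  by apply: d; rewrite inE ?hl' ?hl'' orbT.
move=> e e' h [l' /= hl' h']; apply: (d l l') => //; rewrite ?inE ?eqxx ?hl' ?orbT //.
by move=> ll'; move: ls; rewrite ll' hl'.
Qed.

(** * Completeness *)

Record state := State { ses : session; pst : {fset Part}; typ : gtype }.
Implicit Types (st : state).

Section Completeness.
(* [K p P] stands for "[P] is reachable from the initial process of [p]". *)
Context (K : Part -> proc -> Prop) (G0 : gtype).
Context (K_eq : forall p P Q, proc_eq P Q -> K p P -> K p Q).
Context (K_out : forall p q Ps l P, K p (POut q Ps) -> Ps.[? l] = Some P -> K p P).
Context (K_in : forall p q Ps l P, K p (PIn q Ps) -> Ps.[? l] = Some P -> K p P).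

(** The invariant along a branch. Its clauses confine a state to finitely many cases: typing bounds
    the p-set by the active participants, the middle clauses bound the session and the last one the
    type. *)
Definition good st : Prop :=
  [/\ typing (pst st) (ses st) (typ st),
      forall p, cnt (pred1 p) (ses st) <= 1,
      all_comp K (ses st) & gtree_sub (typ st) G0].

(** Numbering labels by their index in the domain makes positions in the derivation lists of
    naturals, which have codes. *)
Definition branch (Ps : {fmap Msg -> proc}) (l : Msg) : nat := index l (domf Ps).

(* One step of the typing derivation of [st], with [c a] as its [a]-th premise. *)
Inductive node (c : nat -> state) st : Prop :=
| node_End p :
    ses st ≡ p⟦PNil _ _⟧ -> pst st = fset0 -> typ st = GEnd _ _ :> gtree -> node c st
| node_Comm p q Ps Qs M Gs :
    ses st ≡ p⟦POut q Ps⟧ ∥ q⟦PIn p Qs⟧ ∥ M ->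
    (domf Ps `<=` domf Qs)%fset ->
    typ st = GComm p q Gs :> gtree -> domf Gs = domf Ps ->
    pst st = (\bigcup_(l <- domf Ps) pst (c (branch Ps l)))%fset ->
    (forall l P Q G, Ps.[? l] = Some P -> Qs.[? l] = Some Q -> Gs.[? l] = Some G ->
       [/\ good (c (branch Ps l)),
           ses (c (branch Ps l)) = p⟦P⟧ ∥ q⟦Q⟧ ∥ M,
           typ (c (branch Ps l)) = G :> gtree
         & (prtG G `|` [set` pst (c (branch Ps l))]) `\` [set p; q] = prtS M]) ->
    node c st
| node_Weak M2 (P2 : {fset Part}) :
    ses st ≡ ses (c 0) ∥ M2 -> [set` P2] = prtS M2 -> P2 != fset0 ->
    pst st = (pst (c 0) `|` P2)%fset -> typ st = typ (c 0) -> good (c 0) ->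
    node c st.

(** Inversion of the typing derivation. A premise of Comm keeps the invariant because continuations
    and branches are subterms and no participant gains an active component. *)
Lemma node_exists st : good st -> exists c, node c st.
Proof.
case: st => M A G [/= ty cM kM sG].
have isG : is_gtype G by case: G {ty sG}.
move eT: (gtype_tree G) ty => T0 ty.
case: ty eT => [{}M p hM|{}M p q Ps Qs M' Pi Gs hM hd hG h hp hb
  |{}M M1 M2 P1 P2 {}T0 hM h1 h2 h0] eT in cM kM *.
- by exists (fun=> State M fset0 G); exact: (node_End (st := State _ _ _) _ hM).
- have [[k1 k2] k3] := (all_comp_scong K_eq hM).1 kM.
  (* Labels outside the domain get a dummy state, so that choice yields a total function. *)
  have spec l : exists st', l \in domf Ps ->
      forall P Q T, Ps.[? l] = Some P -> Qs.[? l] = Some Q -> Gs.[? l] = Some T ->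
      [/\ good st', pst st' = Pi l, ses st' = p⟦P⟧ ∥ q⟦Q⟧ ∥ M' & typ st' = T :> gtree].
    have [lP|//] := boolP (l \in domf Ps); last by exists (State M fset0 G).
    have [P hP] := domf_fnd lP.
    have [Q hQ] := domf_fnd (fsubsetP hd _ lP).
    have [T hT] : exists T, Gs.[? l] = Some T by apply: domf_fnd; rewrite hG.
    have subT : gtree_sub T G by rewrite eT; apply: gtree_sub_Comm hT _; constructor.
    exists (State (p⟦P⟧ ∥ q⟦Q⟧ ∥ M') (Pi l) (GType (is_gtype_sub subT isG))) => _ P' Q' T'.
    rewrite hP hQ hT => -[<-] [<-] [<-]; split=> //; split=> /=.
    + exact: h hP hQ hT.
    + move=> r; apply: leq_trans (cM r); rewrite (cnt_scong _ hM) /= leq_add2r.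
      by apply: leq_add; rewrite ?leq_b1 //; case: (active _).
    + split=> //; split=> _; first exact: K_out (k1 isT) hP.
      exact: K_in (k2 isT) hQ.
    + exact: gtree_sub_trans sG.
  have [f hf] := choice spec.
  pose c a := nth (State M fset0 G) [seq f l | l <- domf Ps] a.
  have cE l : l \in domf Ps -> c (branch Ps l) = f l.
    move=> lP; rewrite /c (nth_map l) ?nth_index //.
    by rewrite index_mem.
  exists c; apply: (node_Comm (st := State _ _ _) hM hd eT hG) => /=.
  + apply: eq_big_seq => l lP; rewrite cE //.
    have [P hP] := domf_fnd lP.
    have [Q hQ] := domf_fnd (fsubsetP hd _ lP).
    have [T hT] : exists T, Gs.[? l] = Some T by apply: domf_fnd; rewrite hG.
    by have [_ ->] := hf l lP _ _ _ hP hQ hT.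
  + move=> l P Q T hP hQ hT; have lP := fnd_domf hP; rewrite cE //.
    have [g1 g2 g3 g4] := hf l lP _ _ _ hP hQ hT.
    by split=> //; rewrite g2; exact: hp hT.
- exists (fun=> State M1 P1 G).
  have := @node_Weak (fun=> State M1 P1 G) (State M (P1 `|` P2)%fset G) M2 P2 hM h2 h0.
  apply=> //.
  split=> //=; first by rewrite eT.
    by move=> r; apply: leq_trans (cM r); rewrite (cnt_scong _ hM) leq_addr.
  by have [] := (all_comp_scong K_eq hM).1 kM.
Qed.

(** * States up to congruence and bisimilarity *)

Definition sim st (c : session * {fset Part} * gtree) : Prop :=
  [/\ ses st ≡ c.1.1, pst st = c.1.2 & gtree_eq (typ st) c.2].

(** [L] represents every good state and [B] bounds the number of branches of a Comm; regularity will
    provide both. [step] fixes the premises of each good state. *)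
Context (L : seq (session * {fset Part} * gtree)) (B : nat).
Context (hL : forall st, good st -> exists2 c, List.In c L & sim st c).
Context (hB : forall p q Gs, gtree_sub (GComm p q Gs) G0 -> #|` domf Gs| <= B).
Context (step : state -> nat -> state) (root : state).
Context (stepP : forall st, good st -> node (step st) st).

(** For a good state this is the index of its first representative, below [size L]; repeated states
    are detected by comparing these numbers. *)
Definition class st : nat := find (fun c => `[< sim st c >]) L.

Lemma has_class st : good st -> has (fun c => `[< sim st c >]) L.
Proof.
move=> /hL[c]; elim: L => //= a s IH [->|cs] h; first by rewrite asboolT.
by rewrite IH ?orbT.
Qed.

Lemma class_lt st : good st -> class st < size L.
Proof. by move=> /has_class; rewrite has_find. Qed.

Lemma class_eq st st' : good st -> good st' -> class st = class st' ->
  [/\ ses st ≡ ses st', pst st = pst st' & gtree_eq (typ st) (typ st')].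
Proof.
move=> gst gst' e; have c0 : session * {fset Part} * gtree := (ses st, pst st, typ st : gtree).
have /asboolP[h1 h2 h3] := nth_find c0 (has_class gst).
have /asboolP[] := nth_find c0 (has_class gst').
rewrite -/(class st') -e -/(class st) => h1' h2' h3'; split.
- exact: scong_trans h1 (scong_sym h1').
- by rewrite h2 h2'.
- exact: gtree_eq_trans h3 (gtree_eq_sym h3').
Qed.

(* A position lists the branches taken from the root of the derivation. *)
Definition at_pos (u : seq nat) : state := foldl step root u.

Lemma at_rcons u a : at_pos (rcons u a) = step (at_pos u) a.
Proof. by rewrite /at_pos foldl_rcons. Qed.

(* Variables are codes of positions, up to the swap that makes [r] the variable of
   the root. *)
Definition swap (r n : nat) : nat :=
  if n == CodeSeq.code [::] then r else if n == r then CodeSeq.code [::] else n.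

Lemma swapK r : involutive (swap r).
Proof.
move=> n; rewrite /swap; have [->|n0] := eqVneq n (CodeSeq.code [::]).
  by rewrite eqxx; case: eqP.
have [->|nr] := eqVneq n r; first by rewrite eqxx.
by rewrite (negPf n0) (negPf nr).
Qed.

Definition var (r : nat) (u : seq nat) : nat := swap r (CodeSeq.code u).
Definition unvar (r n : nat) : seq nat := CodeSeq.decode (swap r n).

Lemma varK r : cancel (var r) (unvar r).
Proof. by move=> u; rewrite /unvar /var swapK CodeSeq.codeK. Qed.

Lemma var_root r : var r [::] = r.
Proof. by rewrite /var /swap eqxx. Qed.

(** * The candidate solution *)

Context (x X : nat) (W : seq (seq nat)).
Context (hW : forall u, size u <= size L -> all (fun a => a <= B) u -> u \in W).

(** [W] contains every position that the derivation can visit, which keeps the domain finite; a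
    variable is decoded to its position, whose state supplies the value. *)
Definition sol_subst : subst :=
  Subst [fmap n : [fset var X u | u in W]%fset => typ (at_pos (unvar X (fsval n)))]
        [fmap n : [fset var x u | u in W]%fset => pst (at_pos (unvar x (fsval n)))].
Local Notation theta := sol_subst.

Lemma tsub_var u : u \in W -> (tsub theta).[? var X u] = Some (typ (at_pos u)).
Proof.
move=> uW; rewrite /= (fnd_fmap_fset _ (fun n => typ (at_pos (unvar X n)))) varK.
by rewrite (in_imfset _ (var X)).
Qed.

Lemma psub_var u : u \in W -> (psub theta).[? var x u] = Some (pst (at_pos u)).
Proof.
move=> uW; rewrite /= (fnd_fmap_fset _ (fun n => pst (at_pos (unvar x n)))) varK.
by rewrite (in_imfset _ (var x)).
Qed.

(** * Repetition-free positions and their goals *)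

Definition hist (u : seq nat) : seq nat :=
  [seq class (at_pos (take k u)) | k <- iota 0 (size u)].

Definition goal_at (u : seq nat) : goal := Goal (ses (at_pos u)) (var x u) (var X u).

Definition goals_above (u : seq nat) : set goal :=
  [set g | exists2 k, k < size u & g = goal_at (take k u)].

(** [hist] covers proper prefixes only: the state at [u] itself may repeat an earlier class, in
    which case the branch is closed by Cycle. *)
Definition path_ok (u : seq nat) : Prop :=
  [/\ all (fun a => a <= B) u, forall k, good (at_pos (take k u)) & uniq (hist u)].

Lemma hist_rcons u a : hist (rcons u a) = rcons (hist u) (class (at_pos u)).
Proof.
rewrite /hist size_rcons -addn1 iotaD map_cat cats1 add0n -(cats1 u a).
rewrite take_size_cat //; congr rcons; apply/eq_in_map => k.
by rewrite mem_iota => /andP[_ ku]; rewrite takel_cat // ltnW.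
Qed.

Lemma path_ok_at u : path_ok u -> good (at_pos u).
Proof. by case=> _ /(_ (size u)); rewrite take_size. Qed.

(** Pigeonhole: the proper prefixes have distinct classes, all below [size L]. *)
Lemma path_ok_size u : path_ok u -> size u <= size L.
Proof.
case=> _ gu uu; rewrite -(size_iota 0 (size L)) -(size_iota 0 (size u)).
rewrite -(size_map (fun k => class (at_pos (take k u)))).
apply: uniq_leq_size uu _ => i /mapP[k _ ->]; rewrite mem_iota /=.
exact: class_lt.
Qed.

Lemma path_ok_W u : path_ok u -> u \in W.
Proof. by move=> hu; apply: hW; [exact: path_ok_size|case: hu]. Qed.

Lemma path_ok_rcons u a : path_ok u -> class (at_pos u) \notin hist u ->
  a <= B -> good (at_pos (rcons u a)) -> path_ok (rcons u a).
Proof.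
move=> [h1 h2 h3] hn aB ga; split.
- by rewrite all_rcons aB.
- move=> k; have [ku|ku] := leqP k (size u); first by rewrite -cats1 takel_cat.
  by rewrite take_oversize // size_rcons.
- by rewrite hist_rcons rcons_uniq hn.
Qed.

Lemma path_ok_take u k : path_ok u -> k <= size u -> path_ok (take k u).
Proof.
move=> [h1 h2 h3] ku; split.
- by apply/allP => a /mem_take; exact: (allP h1).
- by move=> j; rewrite -take_min.
- have -> // : hist (take k u) = take k (hist u).
    rewrite /hist -map_take take_iota size_takel // (minn_idPl ku).
    by apply/eq_in_map => j; rewrite mem_iota => /andP[_ /ltnW jk]; rewrite take_takel.
  exact: take_uniq.
Qed.

Lemma var_inj r : injective (var r).
Proof. exact: can_inj (varK r). Qed.

(** The goals above [u] are coded by its proper prefixes, which differ in length from each other and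
    from [u], and coding is injective. *)
Lemma goals_wf_at u : goals_wf (goals_above u) (var x u) (var X u).
Proof.
have neq j k : j < k -> k <= size u -> take j u <> take k u.
  move=> jk ku /(congr1 size); rewrite !size_takel // ?(ltnW (leq_trans jk ku)) // => e.
  by move: jk; rewrite e ltnn.
split=> [_ _ [j ju ->] [k ku ->] jk|_ [k ku ->]] /=.
- have ne : take j u <> take k u by move=> e; apply: jk; rewrite e.
  by split=> /var_inj.
- by have := neq _ _ ku (leqnn _); rewrite take_size => ne; split=> /var_inj.
Qed.

Lemma goals_above_rcons u a :
  goals_above (rcons u a) = goals_above u `|` [set goal_at u].
Proof.
have tk k : k <= size u -> take k (rcons u a) = take k u.
  by move=> ku; rewrite -cats1 takel_cat.
apply/seteqP; split=> [_ [k + ->]|_ [[k ku ->]|->]].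
- rewrite size_rcons ltnS => ku; rewrite tk //.
  move: ku; rewrite leq_eqVlt => /predU1P[->|ku]; first by right; rewrite take_size.
  by left; exists k.
- by exists k; [rewrite size_rcons ltnS ltnW|rewrite tk // ltnW].
- by exists (size u); [rewrite size_rcons|rewrite tk // take_size].
Qed.

(** * Construction of the inference derivation *)

Definition teq_ok (e : tvar * tpat Part Msg) : Prop :=
  (forall Y, Y = e.1 \/ tvar_in Y e.2 -> Y \in domf (tsub theta)) /\
  exists G : gtype,
    [/\ (tsub theta).[? e.1] = Some G, gtree_eq G (tinst theta e.2) & bounded G].

Definition peq_ok (e : pvar * ppat Part) : Prop :=
  (forall y, y = e.1 \/ pvar_in y e.2 -> y \in domf (psub theta)) /\
  (psub theta).[? e.1] = Some (pinst theta e.2).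

(** Solving is a property of single equations, so a union of systems can be checked one equation at
    a time. *)
Lemma solP E Pi C : sol E Pi C theta <->
  [/\ forall e, E e -> teq_ok e, forall e, Pi e -> peq_ok e
    & forall c, C c -> agrees theta c].
Proof.
split=> [[[h1 h2] [h3 h4] h5]|[h1 h2 h3]].
  split=> // -[Y T] h; split.
  - by move=> Z; exact: h1 h.
  - exact: h2.
  - by move=> Z; exact: h3 h.
  - exact: h4.
split=> //; split.
- by move=> Y T Z /h1[h _]; exact: h.
- by move=> Y T /h1[_].
- by move=> Y T Z /h2[h _]; exact: h.
- by move=> Y T /h2[_].
Qed.

(** Left-hand sides stay in the subtree at [u]. Siblings differ at the letter after their common
    prefix, so their variables are disjoint, and none of them is the variable of the parent. *)
Definition below (T : Type) (r : nat) (u : seq nat) (E : set (nat * T)) : Prop :=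
  forall e, E e -> exists v, e.1 = var r (u ++ v).

Lemma below_rcons (T : Type) r u a (E : set (nat * T)) :
  below r (rcons u a) E -> below r u E.
Proof. by move=> h e /h[v ->]; exists (a :: v); rewrite cat_rcons. Qed.

Lemma below_neq (T : Type) r u a (E : set (nat * T)) e :
  below r (rcons u a) E -> E e -> var r u <> e.1.
Proof.
move=> h /h[v ->] /var_inj /(congr1 size) /eqP.
by rewrite cat_rcons size_cat /= -{1}[size u]addn0 eqn_add2l.
Qed.

Lemma below_disj (T : Type) r u a a' (E E' : set (nat * T)) e e' : a <> a' ->
  below r (rcons u a) E -> below r (rcons u a') E' -> E e -> E' e' -> e.1 <> e'.1.
Proof.
move=> aa' h h' /h[v ->] /h'[v' ->] /var_inj; rewrite !cat_rcons => /eqP.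
by rewrite eqseq_cat // eqxx /= eqseq_cons => /andP[/eqP].
Qed.

(** The clause [below] accompanies the derivation because Comm and Weak merge systems, and disjoint
    left-hand sides keep one equation per variable. *)
Definition derivable_at (u : seq nat) (E : teqs Part Msg) (Pi : peqs Part)
    (C : set (pcond Part)) : Prop :=
  [/\ infer (goals_above u) (ses (at_pos u)) (var x u) (var X u) E Pi C,
      sol E Pi C theta, is_system E /\ is_system Pi
    & below X u E /\ below x u Pi].

Lemma tsub_dom u : u \in W -> var X u \in domf (tsub theta).
Proof. by move=> uW; apply: (@fnd_domf _ _ _ _ (typ (at_pos u))); exact: tsub_var. Qed.

Lemma psub_dom u : u \in W -> var x u \in domf (psub theta).
Proof. by move=> uW; apply: (@fnd_domf _ _ _ _ (pst (at_pos u))); exact: psub_var. Qed.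

Lemma good_bounded st : good st -> bounded (typ st).
Proof. by case=> /typing_facts[]. Qed.

Lemma pvar_in_punion (s : seq pvar) y : pvar_in y (punion Part s) -> y \in s.
Proof.
case: s => [//|z s] /=.
suff h U : pvar_in y (foldl (@PUnion Part) U [seq PVar Part y | y <- s]) ->
    pvar_in y U \/ y \in s.
  by rewrite inE => /h[/= ->|->]; rewrite ?eqxx ?orbT.
elim: s U => [|w s IH] U /=; first by left.
move=> /IH[[h|/= ->]|h]; [by left|right|right]; rewrite inE ?eqxx //.
by rewrite h orbT.
Qed.

Lemma infer_at u : path_ok u -> exists E Pi C, derivable_at u E Pi C.
Proof.
(* The measure drops at each extension because repetition-free positions have length at most
   [size L]. *)
have [n] := ubnP (size L - size u); elim: n => // n IH in u * => hn hu.
have uW := path_ok_W hu; have gu := path_ok_at hu.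
have bu := good_bounded gu.
(* A class seen before is a repeated goal: Cycle refers to the prefix of length [k]. *)
have [/mapP[k]|hNu] := boolP (class (at_pos u) \in hist u).
  rewrite mem_iota /= => ku /class_eq[] //; first by case: hu.
  move=> hses hpst htyp.
  have kW : take k u \in W by apply: path_ok_W; apply: path_ok_take => //; exact: ltnW.
  exists [set (var X u, TVar Part Msg (var X (take k u)))],
         [set (var x u, PVar Part (var x (take k u)))], set0; split.
  - apply: (inf_Cycle (M' := ses (at_pos (take k u)))) => //; first exact: goals_wf_at.
    by exists k.
  - apply/solP; split=> // _ ->; split=> /=.
    + move=> Y [->|hY]; first exact: tsub_dom.
      by inversion hY; exact: tsub_dom.
    + by exists (typ (at_pos u)); rewrite !tsub_var.
    + by move=> y [->|->]; exact: psub_dom.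
    + by rewrite !psub_var //= hpst.
  - by split; exact: is_system1.
  - by split=> _ ->; exists [::]; rewrite cats0.
(* With a new class, the position may be extended by any branch leading to a good state, and the
   induction hypothesis applies there. *)
have next a : a <= B -> good (step (at_pos u) a) ->
    path_ok (rcons u a) /\ exists E Pi C, derivable_at (rcons u a) E Pi C.
  rewrite -at_rcons => aB ga; have ok := path_ok_rcons hu hNu aB ga.
  split=> //; apply: (IH _ _ ok); have := path_ok_size ok; rewrite size_rcons => lt.
  by rewrite -ltnS; apply: leq_trans hn; rewrite ltnS ltn_sub2l.
case: (stepP gu) => [p hM hP hG|p q Ps Qs M Gs hM hd hG hGs hP hch|M2 P2 hM hP2 h0 hP hG h1].
- exists [set (var X u, TEnd Part Msg)], [set (var x u, PSet fset0)], set0; split.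
  + by apply: (inf_End (p := p)) => //; exact: goals_wf_at.
  + apply/solP; split=> // _ ->; split=> /=.
    * by move=> Y [->|hY]; [exact: tsub_dom|inversion hY].
    * by exists (typ (at_pos u)); rewrite tsub_var //; split=> //; rewrite hG; constructor.
    * by move=> y [->|//]; exact: psub_dom.
    * by rewrite psub_var // hP.
  + by split; exact: is_system1.
  + by split=> _ ->; exists [::]; rewrite cats0.
(* The number of labels is at most [B] since the type occurs in [G0]. *)
- have brB l : l \in domf Ps -> branch Ps l <= B.
    move=> lP; apply: leq_trans (hB (p := p) (q := q) (Gs := Gs) _).
      by rewrite hGs ltnW // index_mem.
    by rewrite -hG; case: gu.
  have child l : l \in domf Ps -> exists P Q G,
      [/\ Ps.[? l] = Some P, Qs.[? l] = Some Q & Gs.[? l] = Some G].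
    move=> lP; have [P eP] := domf_fnd lP; have [Q eQ] := domf_fnd (fsubsetP hd _ lP).
    have [G eG] : exists G, Gs.[? l] = Some G by apply: domf_fnd; rewrite hGs.
    by exists P, Q, G.
  pose v l := rcons u (branch Ps l).
  (* The results of each branch form one triple, so that choice makes them functions of the label;
     labels outside the domain get empty systems. *)
  have sub l : exists R : teqs Part Msg * peqs Part * set (pcond Part),
      l \in domf Ps -> path_ok (v l) /\ derivable_at (v l) R.1.1 R.1.2 R.2.
    have [lP|//] := boolP (l \in domf Ps); last by exists (set0, set0, set0).
    have [P [Q [G [eP eQ eG]]]] := child l lP.
    have [g _ _ _] := hch l P Q G eP eQ eG.
    have [ok [E [Pi [C d]]]] := next _ (brB l lP) g.
    by exists (E, Pi, C).
  have [R hR] := choice sub.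
  have vW l : l \in domf Ps -> v l \in W by move=> /hR[ok _]; exact: path_ok_W.
  (* Distinct labels give distinct letters, whence the disjointness of the variables of different
     branches. *)
  have br_inj l l' : l \in domf Ps -> l' \in domf Ps -> l <> l' ->
      branch Ps l <> branch Ps l'.
    by move=> lP lP' ll' /index_inj => /(_ l lP lP').
  exists ([set (var X u, TComm p q [fmap l : domf Ps => TVar Part Msg (var X (v (val l)))])]
         `|` \bigcup_(l in [set` domf Ps]) (R l).1.1),
    ([set (var x u, punion Part [seq var x (v l) | l <- domf Ps])]
         `|` \bigcup_(l in [set` domf Ps]) (R l).1.2),
    ([set PCond (var X (v l)) (var x (v l)) p q (prt_fset M) | l in [set` domf Ps]]
         `|` \bigcup_(l in [set` domf Ps]) (R l).2).
  split.
  + apply: (inf_Comm (y := fun l => var x (v l)) (Y := fun l => var X (v l))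
      (E := fun l => (R l).1.1) (Pi := fun l => (R l).1.2)) hM hd (prt_fsetE M) _ _.
    * exact: goals_wf_at.
    * move=> l P Q eP eQ; have lP := fnd_domf eP.
      have [P' [Q' [G [eP' eQ' eG]]]] := child l lP.
      have [_ <- _ _] := hch l P Q G eP eQ eG.
      have [_ [d _ _ _]] := hR l lP.
      by rewrite -at_rcons -/(goal_at u) -(goals_above_rcons _ (branch Ps l)).
    * move=> l l' lP lP' ll'; have br := br_inj _ _ lP lP' ll'.
      have [_ [_ _ _ [b1 b2]]] := hR l lP; have [_ [_ _ _ [b1' b2']]] := hR l' lP'.
      split; apply/seteqP; split=> // _ [[e he <-] [e' he' ee']].
        exact: (below_disj br b1 b1' he he').
      exact: (below_disj br b2 b2' he he').
  + apply/solP; split=> [e [->|[l lP he]]|e [->|[l lP he]]|c [[l lP <-]|[l lP he]]].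
    * split=> /= [Y [->|hY]|]; first exact: tsub_dom.
        inversion hY as [|p' q' Ts l T hT hY']; subst; move: hT.
        rewrite (fnd_fmap_fset _ (fun l => TVar Part Msg (var X (v l)))).
        by case: ifP => // lP [eT]; subst T; inversion hY'; exact: tsub_dom (vW _ lP).
      exists (typ (at_pos u)); rewrite tsub_var //; split=> //.
      rewrite hG; constructor=> [//|l G H eG]; rewrite (fnd_fmap_comp _ (tinst theta)).
      rewrite (fnd_fmap_fset _ (fun l => TVar Part Msg (var X (v l)))).
      case: ifP => // lP [<-] /=; rewrite tsub_var ?vW // at_rcons.
      have [P' [Q' [G' [eP' eQ' eG']]]] := child l lP.
      by have [_ _ -> _] := hch l _ _ _ eP' eQ' eG; exact: gtree_eq_refl.
    * by have [_ [_ /solP[h _ _] _ _]] := hR l lP; exact: h.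
    * split=> /= [y [->|/pvar_in_punion/mapP[l lP ->]]|]; first exact: psub_dom.
        by apply: psub_dom; exact: vW.
      rewrite psub_var // pinst_punion big_map hP; congr Some.
      by apply: eq_big_seq => l lP; rewrite psub_var ?vW //= at_rcons.
    * by have [_ [_ /solP[_ h _] _ _]] := hR l lP; exact: h.
    * exists (typ (at_pos (v l))), (pst (at_pos (v l))) => /=.
      rewrite tsub_var ?vW // psub_var ?vW //; split=> //.
      have [P [Q [G [eP eQ eG]]]] := child l lP.
      by have [_ _ eT] := hch l P Q G eP eQ eG; rewrite at_rcons eT prt_fsetE.
    * by have [_ [_ /solP[_ _ h] _ _]] := hR l lP; exact: h.
  + split; (apply: is_systemU; first exact: is_system1).
    * apply: is_system_bigcup => [l lP|l l' e e' lP lP' ll']; first by have [_ [_ _ []]] := hR l lP.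
      have [_ [_ _ _ [b1 _]]] := hR l lP; have [_ [_ _ _ [b1' _]]] := hR l' lP'.
      exact: (below_disj (br_inj _ _ lP lP' ll') b1 b1').
    * move=> _ e -> [l lP he]; have [_ [_ _ _ [b1 _]]] := hR l lP.
      exact: below_neq b1 he.
    * apply: is_system_bigcup => [l lP|l l' e e' lP lP' ll']; first by have [_ [_ _ []]] := hR l lP.
      have [_ [_ _ _ [_ b2]]] := hR l lP; have [_ [_ _ _ [_ b2']]] := hR l' lP'.
      exact: (below_disj (br_inj _ _ lP lP' ll') b2 b2').
    * move=> _ e -> [l lP he]; have [_ [_ _ _ [_ b2]]] := hR l lP.
      exact: below_neq b2 he.
  + split=> e [->|[l lP he]]; try by exists [::]; rewrite cats0.
    * by have [_ [_ _ _ [b1 _]]] := hR l lP; exact: below_rcons b1 _ he.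
    * by have [_ [_ _ _ [_ b2]]] := hR l lP; exact: below_rcons b2 _ he.
- have [ok [E [Pi [C [d s [sE sP] [bE bP]]]]]] := next 0 (leq0n _) h1.
  have okW := path_ok_W ok.
  exists ([set (var X u, TVar Part Msg (var X (rcons u 0)))] `|` E),
    ([set (var x u, PUnion (PVar Part (var x (rcons u 0))) (PSet P2))] `|` Pi), C; split.
  + apply: (inf_Weak (M1 := ses (step (at_pos u) 0))) hM hP2 h0 _.
      exact: goals_wf_at.
    by rewrite -at_rcons -/(goal_at u) -(goals_above_rcons _ 0).
  + move/solP: s => [s1 s2 s3]; apply/solP; split=> // e [->|he]; try by [exact: s1|exact: s2].
    * split=> /= [Y [->|hY]|]; first exact: tsub_dom.
        by inversion hY; exact: tsub_dom.
      exists (typ (at_pos u)); rewrite !tsub_var // at_rcons -hG; split=> //.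
      exact: gtree_eq_refl.
    * split=> /= [y [->|[->|//]]|]; try exact: psub_dom.
      by rewrite !psub_var //= at_rcons hP.
  + split; (apply: is_systemU => //; first exact: is_system1) => _ e ->.
      exact: below_neq bE.
    exact: below_neq bP.
  + split=> e [->|he]; try by exists [::]; rewrite cats0.
    * exact: below_rcons bE _ he.
    * exact: below_rcons bP _ he.
Qed.

End Completeness.

(** * Finiteness from regularity *)

Lemma mem_In (T : eqType) (a : T) (s : seq T) : a \in s -> List.In a s.
Proof. by elim: s => //= b s IH; rewrite inE => /predU1P[->|/IH]; [left|right]. Qed.

Lemma In_mem_map (T : Type) (U : eqType) (f : T -> U) a (s : seq T) :
  List.In a s -> f a \in map f s.
Proof. by elim: s => //= b s IH [->|/IH h]; rewrite inE ?eqxx ?h ?orbT. Qed.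

Lemma words_finite n b : exists W : seq (seq nat),
  forall u, size u <= n -> all (fun a => a <= b) u -> u \in W.
Proof.
elim: n => [|n [W hW]]; first by exists [:: [::]] => -[].
exists ([::] :: [seq a :: w | a <- iota 0 b.+1, w <- W]) => -[//|a u] un /andP[ab ub].
rewrite in_cons; apply/orP; right; apply/allpairsP.
exists (a, u); split=> //; last exact: hW.
by rewrite mem_iota.
Qed.

Lemma regular_finite (s : seq proc) : (forall P, List.In P s -> proc_regular P) ->
  exists t : seq proc, forall P P', List.In P s -> proc_sub P' P ->
    exists2 Q, List.In Q t & proc_eq P' Q.
Proof.
elim: s => [|P s IH] hs; first by exists [::].
have [t ht] := IH (fun Q h => hs Q (or_intror h)).
have [r hr] := hs P (or_introl erefl).
exists (r ++ t) => Q Q' [<-|sQ] sub.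
  by have [R hR e] := hr _ sub; exists R => //; apply/List.in_app_iff; left.
by have [R hR e] := ht _ _ sQ sub; exists R => //; apply/List.in_app_iff; right.
Qed.

(** Bisimilar nodes have the same labels, so the widest of the finitely many representatives gives
    the bound. *)
Lemma width_finite G : gtree_regular G -> exists B, forall p q Gs,
  gtree_sub (GComm p q Gs) G -> #|` domf Gs| <= B.
Proof.
case=> s hs.
pose w H := if H is GComm _ _ Hs then #|` domf Hs| else 0.
exists (\max_(H <- s) w H) => p q Gs /hs[H sH eH].
have -> : #|` domf Gs| = w H by inversion eH as [|p' q' Gs' Hs e h]; rewrite /= e.
elim: s sH {hs} => //= H' s IH [->|/IH h]; rewrite big_cons leq_max ?leqnn //.
by rewrite h orbT.
Qed.

Lemma all_comp_cnt (K : Part -> proc -> Prop) M p :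
  all_comp K M -> 0 < cnt (pred1 p) M -> exists P, K p P.
Proof.
elim: M => [q P|M IHM N IHN] /=; last first.
  by case=> /IHM hM /IHN hN; rewrite addn_gt0 => /orP[/hM|/hN].
by case: (active P) => //= /(_ isT) h; case: eqP => // <- _; exists P.
Qed.

Lemma infer_complete M A (G : gtype) (x : pvar) (X : tvar) :
  is_session M -> typing A M G -> exists E Pi C (theta : subst),
    [/\ is_system E /\ is_system Pi, infer set0 M x X E Pi C, sol E Pi C theta,
        (tsub theta).[? X] = Some G & (psub theta).[? x] = Some A].
Proof.
move=> [uM hM] ty.
pose ps := [seq pP.1 | pP <- components M].
pose s := List.map snd (components M).
(* Any participant of [M] may go with any subterm of any component, up to bisimilarity: coarser than
   reachability, but closed under continuations and still finite. *)
pose K (p : Part) P := p \in ps /\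
  exists R P', [/\ List.In R s, proc_sub P' R & proc_eq P P'].
have K_eq p P Q : proc_eq P Q -> K p P -> K p Q.
  move=> PQ [hp [R [P' [h1 h2 h3]]]]; split=> //; exists R, P'; split=> //.
  exact: proc_eq_trans (proc_eq_sym PQ) h3.
have K_out p q Ps l P : K p (POut q Ps) -> Ps.[? l] = Some P -> K p P.
  move=> [hp [R [P' [h1 h2 h3]]]] hl; split=> //.
  inversion h3 as [|q' Ps' Qs e h|]; subst; have [Q hQ] := fnd_eqdom e hl.
  exists R, Q; split=> //; last exact: h hl hQ.
  by apply: proc_sub_trans h2; apply: proc_sub_Out hQ _; constructor.
have K_in p q Ps l P : K p (PIn q Ps) -> Ps.[? l] = Some P -> K p P.
  move=> [hp [R [P' [h1 h2 h3]]]] hl; split=> //.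
  inversion h3 as [| |q' Ps' Qs e h]; subst; have [Q hQ] := fnd_eqdom e hl.
  exists R, Q; split=> //; last exact: h hl hQ.
  by apply: proc_sub_trans h2; apply: proc_sub_In hQ _; constructor.
have [t ht] : exists t : seq proc, forall P P', List.In P s -> proc_sub P' P ->
    exists2 Q, List.In Q t & proc_eq P' Q.
  by apply: regular_finite => P /List.in_map_iff[[p P'] [<- /hM[]]].
have [p0 _] := components_neq0 M.
have [Ls hLs] := sessions_finite p0 ps t.
have rG : gtree_regular G by case: G {ty} => T [].
have [Lg hLg] := rG; have [B hB] := width_finite rG.
(* A representative combines a session, a set of participants of [M] and a type, each from a finite
   list. *)
pose Lp : seq {fset Part} := fpowerset [fset p in ps]%fset.
pose L := List.list_prod (List.list_prod Ls Lp) Lg.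
have hL st : good K G st -> exists2 c, List.In c L & sim st c.
  move=> [tyst cst Kst sst].
  have [N LN MN] : exists2 N, List.In N Ls & ses st ≡ N.
    apply: hLs cst _; apply: all_compS Kst => p P [hp [R [P' [sR h1 h2]]]]; split=> //.
    by have [Q tQ e] := ht _ _ sR h1; exists Q => //; exact: proc_eq_trans h2 e.
  have [H LH eH] := hLg _ sst.
  exists (N, pst st, H); last by split.
  apply: List.in_prod => //; apply: List.in_prod => //; apply: mem_In.
  (* Members of the p-set are active in the session, hence participants of [M]. *)
  rewrite fpowersetE; apply/fsubsetP => p /((typing_facts tyst).2 p).
  by case/(all_comp_cnt Kst) => P [pps _]; rewrite inE.
(* On states that are not good the value of [step] is arbitrary. *)
have [step hstep] : exists step, forall st, good K G st -> node K G (step st) st.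
  have /choice[f hf] : forall st, exists c, good K G st -> node K G c st.
    move=> st; have [g|ng] := pselect (good K G st); last by exists (fun=> st).
    by have [c hc] := node_exists K_eq K_out K_in g; exists c.
  by exists f.
have [W hW] := words_finite (size L) B.
pose root := State M A G.
have g0 : good K G root.
  split=> //=; last by constructor.
    move=> p; apply: leq_trans (cnt_components M p) _.
    by rewrite count_uniq_mem // leq_b1.
  apply: all_comp_components => p P hP; split; first exact: (In_mem_map fst hP).
  exists P, P; split; [exact: (List.in_map snd _ _ hP)|constructor|exact: proc_eq_refl].
have ok : path_ok K G L B step root [::] by split.
have W0 : [::] \in W by exact: hW.
have [E [Pi [C [d hsol hsys _]]]] := infer_at hL hB hstep x X hW ok.
exists E, Pi, C, (sol_subst step root x X W); split=> //.
(* The swap in the coding makes [x] and [X] the variables of the root, above which there is no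
   goal. *)
- move: d; rewrite !var_root.
  by have -> // : goals_above step root x X [::] = set0 by apply/seteqP; split=> // g [].
- by have := tsub_var step root x X W0; rewrite var_root.
- by have := psub_var step root x X W0; rewrite var_root.
Qed.
End Theory.

Theorem theorem4 (Part Msg : choiceType) (M : session Part Msg)
    (hM : is_session M) (x : pvar) (X : tvar) :
  (forall (E : teqs Part Msg) (Pi : peqs Part) (C : set (pcond Part)),
     infer set0 M x X E Pi C ->
     forall theta : subst Part Msg, sol E Pi C theta ->
     exists (P : {fset Part}) (G : gtype Part Msg),
       [/\ (psub theta).[? x]%fmap = Some P,
           (tsub theta).[? X]%fmap = Some G
         & typing P M G]) /\
  (forall (P : {fset Part}) (G : gtype Part Msg),
     typing P M G ->
     exists (E : teqs Part Msg) (Pi : peqs Part) (C : set (pcond Part))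
       (theta : subst Part Msg),
       [/\ is_system E /\ is_system Pi,
           infer set0 M x X E Pi C,
           sol E Pi C theta,
           (tsub theta).[? X]%fmap = Some G
         & (psub theta).[? x]%fmap = Some P]).
Proof.
split=> [E Pi C hI theta hs|A G]; last exact: infer_complete.
have [[A [G [hA hG]]] hT] := infer_sound hI hs.
exists A, G; split=> //.
(* With no goals assumed, the second alternative is void and the first rests on an empty set of
   hypotheses. *)
have [|h|[g []]] := hT A M G.
- by exists G; split=> //=; [exact: scong_refl|exact: gtree_eq_refl].
- by apply: typing_from0 h => B N H [g []].
Qed.
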